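(* Let $G$ be a finite simple graph of order $n$ and maximum degree $\Delta$. Then $$Mo^\star(G)\leq \left(2\left(\frac{\Delta}{n}\right)^2+\left(\frac{\Delta}{n}\right)-2\left(\frac{\Delta}{n}\right)\sqrt{\left(\frac{\Delta}{n}\right)^2+\left(\frac{\Delta}{n}\right)}\right)n^3.$$
   Context: For a finite simple graph $G$ of order $n$ and a vertex $u$, $d_G(u)$ denotes the degree of $u$ in $G$. The parameter $Mo^\star(G)$ is defined as $Mo^\star(G)=\sum_{uv\in E(G)}\big(n-\min\{d_G(u),d_G(v)\}\big)$, the sum running over all edges $uv$ of $G$. *)

(* Defs.v *)
From mathcomp Require Import all_boot all_order all_algebra.
Set Implicit Arguments.
Unset Strict Implicit.
Unset Printing Implicit Defensive.

Record sgraph := SGraph {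
  vertex :> finType;
  adj : rel vertex;
  adj_sym : symmetric adj;
  adj_irrefl : irreflexive adj
}.

Definition gorder (G : sgraph) : nat := #|G|.

Definition deg (G : sgraph) (u : G) : nat := #|[set v | adj u v]|.

Definition maxdeg (G : sgraph) : nat := \max_(u : G) deg u.

Definition edges (G : sgraph) : {set {set G}} :=
  [set E | [exists u : G, exists v : G, adj u v && (E == [set u; v])]].

(* The default value [gorder G] bounds every degree, so it never affects the
   minimum over the (two) ends of an edge. *)
Definition mindeg_ends (G : sgraph) (E : {set G}) : nat :=
  \big[minn/gorder G]_(u in E) deg u.

(* The truncated subtraction is exact: degrees are at most [gorder G]. *)
Definition Mostar (G : sgraph) : nat :=
  \sum_(E in edges G) (gorder G - mindeg_ends E).

Lemma deg_le_gorder (G : sgraph) (u : G) : deg u <= gorder G.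
Proof. exact: max_card. Qed.

Lemma mindeg_ends_edge (G : sgraph) (u v : G) :
  adj u v -> mindeg_ends [set u; v] = minn (deg u) (deg v).
Proof.
move=> uv; have neq_uv : u != v.
  by apply: contraTneq uv => ->; rewrite adj_irrefl.
rewrite /mindeg_ends -minEnat (Order.TotalTheory.bigminD1 u) ?set21 //=.
rewrite (Order.TotalTheory.bigminD1 v) ?set22 1?eq_sym //= big_pred0 => [|w].
  by rewrite !minEnat (minn_idPl (deg_le_gorder v)).
by rewrite !inE; case: eqP => //=; case: eqP.
Qed.

(* Main.v *)
Require Import Defs.
From mathcomp Require Import all_boot all_order all_algebra.
From mathcomp Require Import ring lra.

(** Put [t = (sqrt (d ^+ 2 + d) - d) * n], the nonnegative root of
    [t ^+ 2 = D * (n - 2 * t)] where [D] is the maximum degree; the bound is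
    [t ^+ 2 * n]. By AM-GM, [a + t ^+ 2 / a >= 2 * t], so an edge with end
    degrees [a <= b <= D] satisfies [n - a <= t ^+ 2 * (a^-1 + b^-1)].
    Summing over the edges, each non-isolated vertex [u] receives
    [deg u * (deg u)^-1 = 1], so the right-hand sides add up to at most
    [t ^+ 2 * n]. *)

Set Implicit Arguments.
Unset Strict Implicit.
Unset Printing Implicit Defensive.

Import Order.TTheory GRing.Theory Num.Theory.

Local Open Scope ring_scope.

(** Split [n - a] as [(2 * t - a) + (n - 2 * t)]. AM-GM bounds the first part by [t ^+ 2 / a]; the
    second equals [t ^+ 2 / D], which is at most [t ^+ 2 / b]. *)
Lemma subr_le_sum_inv (R : realFieldType) (n t D a b : R) :
  0 < a -> 0 < b <= D -> t ^+ 2 = D * (n - 2 * t) ->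
  n - a <= t ^+ 2 * (a^-1 + b^-1).
Proof.
move=> a_gt0 /andP[b_gt0 leb] tE.
have D_gt0 := lt_le_trans b_gt0 leb.
have amgm : 2 * t <= a + t ^+ 2 / a.
  rewrite -subr_ge0.
  have -> : a + t ^+ 2 / a - 2 * t = (a - t) ^+ 2 / a by field; rewrite gt_eqF.
  by rewrite divr_ge0 ?sqr_ge0 ?ltW.
have leD : n - 2 * t <= t ^+ 2 / b.
  have -> : n - 2 * t = t ^+ 2 / D by rewrite tE; field; rewrite gt_eqF.
  by rewrite ler_wpM2l ?sqr_ge0 // lef_pV2 ?posrE.
rewrite mulrDr; lra.
Qed.

Lemma edgesP (G : sgraph) (E : {set G}) :
  reflect (exists u v : G, adj u v /\ E = [set u; v]) (E \in edges G).
Proof.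
rewrite inE; apply: (iffP existsP) => [[u /existsP[v /andP[uv /eqP->]]]|].
  by exists u, v.
by move=> [u [v [uv ->]]]; exists u; apply/existsP; exists v; rewrite uv eqxx.
Qed.

(** Each edge at [u] is the image of a neighbour [v] of [u] under [v |-> [set u; v]]. *)
Lemma card_edges_at (G : sgraph) (u : G) :
  (#|[set E in edges G | u \in E]| <= deg u)%N.
Proof.
apply: leq_trans (leq_imset_card (fun v => [set u; v]) _).
apply/subset_leq_card/subsetP => E; rewrite inE.
case/andP=> /edgesP[x [y [xy ->]]]; rewrite !inE.
case/orP=> /eqP->; apply/imsetP; [exists y | exists x] => //.
- by rewrite inE.
- by rewrite inE adj_sym.
- by rewrite setUC.
Qed.

(** Double counting: once the sums are exchanged, [u] contributes [(deg u)^-1] for each edge at [u],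
    hence at most 1 in total. *)
Lemma sum_edges_inv_deg (R : realFieldType) (G : sgraph) :
  \sum_(E in edges G) \sum_(u in E) (deg u)%:R^-1 <= (gorder G)%:R :> R.
Proof.
rewrite (exchange_big_dep predT) //= /gorder -sum1_card natr_sum.
apply: ler_sum => u _; rewrite sumr_const -[_ *+ #|_|]mulr_natl.
have := card_edges_at u; rewrite cardsE; set k := #|_|; case: (posnP (deg u)) => [-> _|d_gt0 le].
  (* An isolated vertex contributes 0, since the inverse of 0 is 0 by convention. *)
  by rewrite invr0 mulr0 ler01.
by rewrite ler_pdivrMr ?ltr0n // mul1r ler_nat.
Qed.

Lemma deg_le_maxdeg (G : sgraph) (u : G) : (deg u <= maxdeg G)%N.
Proof. exact: leq_bigmax. Qed.

Lemma adj_deg_gt0 (G : sgraph) (u v : G) : adj u v -> (0 < deg u)%N.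
Proof. by move=> uv; apply/card_gt0P; exists v; rewrite inE. Qed.

Lemma edge_weight_le (R : realFieldType) (G : sgraph) (t : R) (E : {set G}) :
  t ^+ 2 = (maxdeg G)%:R * ((gorder G)%:R - 2 * t) -> E \in edges G ->
  (gorder G - mindeg_ends E)%:R <= t ^+ 2 * \sum_(u in E) (deg u)%:R^-1.
Proof.
move=> tE /edgesP[u [v [uv ->]]].
have neq_uv : u != v by apply: contraTneq uv => ->; rewrite adj_irrefl.
have u_gt0 := adj_deg_gt0 uv.
have v_gt0 : (0 < deg v)%N by apply: (@adj_deg_gt0 _ _ u); rewrite adj_sym.
rewrite mindeg_ends_edge // big_setU1 ?inE //= big_set1.
rewrite natrB ?geq_min ?deg_le_gorder //.
(* The end of smaller degree plays the role of [a], the other end that of [b]. *)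
by case: leqP => _; [|rewrite addrC]; apply: subr_le_sum_inv tE;
  rewrite ?ltr0n ?ler_nat ?deg_le_maxdeg ?andbT.
Qed.

Lemma Mostar_le_sqr (R : realFieldType) (G : sgraph) (t : R) :
  t ^+ 2 = (maxdeg G)%:R * ((gorder G)%:R - 2 * t) ->
  (Mostar G)%:R <= t ^+ 2 * (gorder G)%:R.
Proof.
move=> tE; rewrite /Mostar natr_sum.
apply: le_trans (ler_sum _ (fun E EG => edge_weight_le tE EG)) _.
by rewrite -mulr_sumr ler_wpM2l ?sqr_ge0 ?sum_edges_inv_deg.
Qed.

Theorem theorem2 (R : rcfType) (G : sgraph) :
  let n : R := (gorder G)%:R in
  let d : R := (maxdeg G)%:R / n in
  (Mostar G)%:R <= (2 * d ^+ 2 + d - 2 * d * Num.sqrt (d ^+ 2 + d)) * n ^+ 3.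
Proof.
rewrite /=; set n : R := (gorder G)%:R; set d : R := _ / n.
have d_ge0 : 0 <= d by rewrite divr_ge0 ?ler0n.
have sqrtE : Num.sqrt (d ^+ 2 + d) ^+ 2 = d ^+ 2 + d.
  by rewrite sqr_sqrtr ?addr_ge0 ?sqr_ge0.
have DE : (maxdeg G)%:R = d * n.
  (* If [n = 0] the quotient [d] is only a default value, but then the maximum degree, being at most
     the order, is 0 too. *)
  have [n0|n_neq0] := eqVneq n 0; last by rewrite divfK.
  rewrite n0 mulr0; apply/eqP; rewrite pnatr_eq0 -leqn0.
  have : gorder G == 0%N by rewrite -(pnatr_eq0 R) -/n n0.
  by move=> /eqP <-; apply/bigmax_leqP => u _; apply: deg_le_gorder.
set s := Num.sqrt _ in sqrtE *.
(* As [s ^+ 2 = d ^+ 2 + d], the factor of [n ^+ 3] in the bound is a perfect square. *)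
have sE : (s - d) ^+ 2 = 2 * d ^+ 2 + d - 2 * d * s.
  by rewrite sqrrB sqrtE; ring.
have tE : ((s - d) * n) ^+ 2 = (maxdeg G)%:R * (n - 2 * ((s - d) * n)).
  by rewrite exprMn sE DE; ring.
apply: le_trans (Mostar_le_sqr tE) _.
by rewrite exprMn sE -/n [n ^+ 3]exprSr mulrA.
Qed.
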